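(* Let $G$ be a simple connected graph, and let $I(G)$ be its edge ideal in the polynomial ring $K[x_1,\ldots,x_n]$ over a field $K$, where $V(G)=\{x_1,\ldots,x_n\}$. Then $$\mathrm{v}(I(G)^k)=\mathrm{v}(\overline{I(G)^k})=2k-1$$ for all $k\ge 1+|E(G)|$.
   Context: Graphs are finite. For a simple graph $G$ with vertex set $V(G)=\{x_1,\ldots,x_n\}$ and edge set $E(G)$, the edge ideal is $I(G)=(x_ix_j : \{x_i,x_j\}\in E(G))\subseteq R=K[x_1,\ldots,x_n]$, with $R$ standard graded. For a homogeneous ideal $I\subseteq R$, the v-number of $I$ is $$\mathrm{v}(I)=\min\{d\ge 0 : \text{there exist } f\in R_d \text{ and } \mathfrak p\in\operatorname{Ass}(I) \text{ such that } (I:f)=\mathfrak p\},$$ where $R_d$ is the space of homogeneous polynomials of degree $d$, $(I:f)=\{g\in R: gf\in I\}$, and $\operatorname{Ass}(I)$ is the set of associated primes of $R/I$. The integral closure $\overline{I}$ of an ideal $I$ is the ideal of all $x\in R$ satisfying an equation $x^m+a_1x^{m-1}+\cdots+a_m=0$ with $m\ge 1$ and $a_i\in I^i$ for $1\le i\le m$.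
   Formalization: The graph G is assumed to have at least one edge; for the one-vertex connected graph the edge ideal is 0, so the v-number of every power is 0 rather than 2k-1, and the claim as stated fails there. *)

(* Defs.v *)
From HB Require Import structures.
From mathcomp Require Import all_boot all_order all_algebra.
From mathcomp Require Import mpoly.

Set Implicit Arguments.
Unset Strict Implicit.
Unset Printing Implicit Defensive.

Import GRing.Theory.
Local Open Scope ring_scope.

Section Ideals.

Variable R : comNzRingType.

(* Ideals are Prop-valued predicates, compared extensionally: membership in
   an integral closure or in a colon ideal is not given by a boolean test. *)
Implicit Types (S I J P : R -> Prop).

Definition ideal_eq I J : Prop := forall x, I x <-> J x.

Definition ideal_gen S : R -> Prop := fun x =>
  exists s : seq (R * R),
    (forall c, c \in s -> S c.2) /\ x = \sum_(c <- s) c.1 * c.2.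

Definition ideal_exp I (k : nat) : R -> Prop :=
  ideal_gen (fun y => exists u : 'I_k -> R,
    (forall i, I (u i)) /\ y = \prod_(i < k) u i).

Definition colon I (f : R) : R -> Prop := fun g => I (g * f).

Definition is_ideal I : Prop :=
  [/\ I 0, forall x y, I x -> I y -> I (x + y) & forall a x, I x -> I (a * x)].

Definition is_prime_ideal P : Prop :=
  [/\ is_ideal P, ~ P 1 & forall x y, P (x * y) -> P x \/ P y].

(* P is an associated prime of R / I: the annihilator of the class of some g. *)
Definition associated_prime I P : Prop :=
  is_prime_ideal P /\ exists g : R, ideal_eq P (colon I g).

Definition integral_closure I : R -> Prop := fun x =>
  exists (m : nat) (a : nat -> R),
    [/\ (1 <= m)%N,
        forall i, (1 <= i <= m)%N -> ideal_exp I i (a i)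
      & x ^+ m + \sum_(1 <= i < m.+1) a i * x ^+ (m - i) = 0].

End Ideals.

Section VNumber.

Variables (K : fieldType) (n : nat).
Implicit Types I : {mpoly K[n]} -> Prop.

Definition vnumber_witness I (d : nat) : Prop :=
  exists (f : {mpoly K[n]}) (P : {mpoly K[n]} -> Prop),
    [/\ f \is d.-homog, associated_prime I P & ideal_eq (colon I f) P].

(* [is_vnumber I d] reads v(I) = d.  As a relation it asserts in particular
   that the set whose minimum is taken is nonempty. *)
Definition is_vnumber I (d : nat) : Prop :=
  vnumber_witness I d /\ forall d', vnumber_witness I d' -> (d <= d')%N.

Lemma is_vnumber_unique I d d' : is_vnumber I d -> is_vnumber I d' -> d = d'.
Proof.
by move=> [wd md] [wd' md']; apply/eqP; rewrite eqn_leq md // md'.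
Qed.

End VNumber.

Section Graphs.

Variable n : nat.
Implicit Type e : rel 'I_n.

Definition simple_graph e : Prop := ssrbool.symmetric e /\ irreflexive e.

Definition connected_graph e : Prop := forall x y : 'I_n, connect e x y.

Definition edge_set e : {set {set 'I_n}} :=
  [set [set p.1; p.2] | p : 'I_n * 'I_n & e p.1 p.2].

Definition edge_ideal (K : fieldType) e : {mpoly K[n]} -> Prop :=
  ideal_gen (fun y : {mpoly K[n]} =>
    exists i j : 'I_n, [set i; j] \in edge_set e /\ y = 'X_i * 'X_j).

End Graphs.

Arguments edge_ideal {n} K e.

(* Main.v *)
(* Grade polynomials by a weight w on the variables, through the substitution
   x_i -> x_i t^(w i). If every edge has weight s, all elements of I^k and of
   its integral closure have order >= s k in t. With w = 1 this gives the lower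
   bound: a prime (J : f) contains I^k, hence some variable x, so x f lies in J
   and has degree at least 2k.
   For the upper bound take f = x_b y with y a product of k - 1 edges, chosen so
   that f has weight s k - 1. Then (J : f) is contained in the prime generated
   by the variables of positive weight, with equality when x_a x_b y is in I^k for
   each such variable x_a. The product y contains every edge, and
   x_a x_b y is in I^k because of an odd walk from a to b whose even-position
   edges are distinct. Such walks come from the 2-colouring of G by the parity
   of the distance to a root, whose bichromatic edges connect G. *)

Require Import Defs.
From HB Require Import structures.
From mathcomp Require Import all_boot all_order all_algebra.
From mathcomp Require Import mpoly.
From mathcomp Require Import zify ring.

Set Implicit Arguments.
Unset Strict Implicit.
Unset Printing Implicit Defensive.

Import GRing.Theory.
Local Open Scope ring_scope.

(** * Ideals, colon ideals and powers *)

Section IdealTheory.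

Variable R : comNzRingType.
Implicit Types S I J : R -> Prop.

Lemma ideal_gen_is_ideal S : is_ideal (ideal_gen S).
Proof.
split=> [|x y [s [Ss ->]] [t [St ->]]|a x [s [Ss ->]]].
- by exists [::]; rewrite big_nil.
- exists (s ++ t); rewrite big_cat; split=> // c.
  by rewrite mem_cat => /orP[/Ss|/St].
- exists [seq (a * c.1, c.2) | c <- s]; split=> [c /mapP[d /Ss Sd ->] //|].
  by rewrite big_map mulr_sumr; apply: eq_bigr => c _; rewrite mulrA.
Qed.

Lemma sub_ideal_gen S x : S x -> ideal_gen S x.
Proof.
move=> Sx; exists [:: (1, x)]; rewrite big_seq1 mul1r.
by split=> // c; rewrite inE => /eqP ->.
Qed.

Lemma ideal_gen_min S J x :
  is_ideal J -> (forall y, S y -> J y) -> ideal_gen S x -> J x.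
Proof.
move=> [J0 JD JM] SJ [s [Ss ->]].
by rewrite big_seq; apply: (big_ind J) => // c /Ss /SJ; apply: JM.
Qed.

Lemma colon_is_ideal J f : is_ideal J -> is_ideal (colon J f).
Proof.
move=> [J0 JD JM]; split; rewrite /colon.
- by rewrite mul0r.
- by move=> x y ? ?; rewrite mulrDl; apply: JD.
- by move=> a x ?; rewrite -mulrA; apply: JM.
Qed.

Lemma ideal_exp_is_ideal I k : is_ideal (ideal_exp I k).
Proof. exact: ideal_gen_is_ideal. Qed.

Lemma ideal_exp1 I x : I x -> ideal_exp I 1 x.
Proof.
move=> Ix; apply: sub_ideal_gen; exists (fun=> x).
by rewrite big_ord_recl big_ord0 mulr1.
Qed.

Lemma sub_integral_closure I x : I x -> integral_closure I x.
Proof.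
move=> Ix; exists 1%N, (fun=> - x); split=> // [i|].
  case/andP=> i1 i2; have ->: i = 1%N by apply/eqP; rewrite eqn_leq i2.
  have [_ _ JM] := ideal_exp_is_ideal I 1.
  by rewrite -mulN1r; apply: JM; apply: ideal_exp1.
by rewrite big_nat1 subnn expr0 mulr1 expr1 subrr.
Qed.

End IdealTheory.

(** * Divisibility by powers of t over a domain *)

Section PowerOfX.

Variable B : idomainType.
Implicit Types p q : {poly B}.

Definition polyX_dvd (d : nat) p : Prop := exists q, p = q * 'X^d.

Lemma polyX_dvd0 d : polyX_dvd d 0.
Proof. by exists 0; rewrite mul0r. Qed.

Lemma polyX_dvdD d p q : polyX_dvd d p -> polyX_dvd d q -> polyX_dvd d (p + q).
Proof. by move=> [u ->] [v ->]; exists (u + v); rewrite mulrDl. Qed.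

Lemma polyX_dvdM c d p q :
  polyX_dvd c p -> polyX_dvd d q -> polyX_dvd (c + d) (p * q).
Proof. by move=> [u ->] [v ->]; exists (u * v); rewrite exprD mulrACA. Qed.

Lemma polyX_dvdMl d p q : polyX_dvd d q -> polyX_dvd d (p * q).
Proof. by move=> [u ->]; exists (p * u); rewrite mulrA. Qed.

Lemma polyX_dvdW c d p : (c <= d)%N -> polyX_dvd d p -> polyX_dvd c p.
Proof.
by move=> cd [q ->]; exists (q * 'X^(d - c)); rewrite -mulrA -exprD subnK.
Qed.

Lemma polyX_dvdX d p m : polyX_dvd d p -> polyX_dvd (d * m) (p ^+ m).
Proof. by move=> [q ->]; exists (q ^+ m); rewrite exprMn exprM. Qed.

(** Cancelling X^c, which is legitimate over a domain, leaves p divisible by a positive power of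
    X. *)
Lemma polyX_dvd_sub c d p :
  (c < d)%N -> polyX_dvd d (p * 'X^c) -> p`_0 = 0.
Proof.
move=> cd [q]; rewrite -(subnK (ltnW cd)) exprD mulrA.
move/(mulIf _) => -> //; last by rewrite expf_neq0 // polyX_eq0.
by rewrite coefMXn subn_gt0 cd.
Qed.

Lemma polyX_factor p : p != 0 -> exists o q, p = q * 'X^o /\ q`_0 != 0.
Proof.
move=> p0; case: (multiplicity_XsubC p 0) => o [q].
rewrite p0 subr0 /= => rq ->; exists o, q; split=> //.
by rewrite -horner_coef0.
Qed.

End PowerOfX.

(** * Orders in t on powers and integral closures *)

Section Valuation.

Variables (A : comNzRingType) (B : idomainType).
Variable phi : {rmorphism A -> {poly B}}.

Lemma polyX_dvd_ideal d : is_ideal (fun x => polyX_dvd d (phi x)).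
Proof.
split=> [|x y|a x].
- by rewrite rmorph0; apply: polyX_dvd0.
- by rewrite rmorphD; apply: polyX_dvdD.
- by rewrite rmorphM; apply: polyX_dvdMl.
Qed.

Lemma polyX_dvd_exp (I : A -> Prop) d k x :
    (forall y, I y -> polyX_dvd d (phi y)) ->
  ideal_exp I k x -> polyX_dvd (d * k) (phi x).
Proof.
move=> Id; apply: (@ideal_gen_min _ _ (fun x => polyX_dvd (d * k) (phi x))).
  exact: polyX_dvd_ideal.
move=> _ [u [Iu ->]]; elim: k u Iu => [|k IHk] u Iu.
  by rewrite muln0; exists (phi (\prod_(i < 0) u i)); rewrite mulr1.
rewrite big_ord_recl rmorphM mulnS; apply: polyX_dvdM; first exact: Id.
exact: (IHk (fun i => u (lift ord0 i))).
Qed.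

(* If phi x had order o < d, every term a_i x^(m-i) with i >= 1 of the
   integral equation would have order > o m, the order of x^m. *)
Lemma polyX_dvd_integral (I : A -> Prop) d x :
    (forall y, I y -> polyX_dvd d (phi y)) ->
  integral_closure I x -> polyX_dvd d (phi x).
Proof.
move=> Id [m [a [m1 Ia eqx]]].
have [->|/polyX_factor [o [q [eq_x q0]]]] := eqVneq (phi x) 0.
  exact: polyX_dvd0.
have [le_do|lt_od] := leqP d o.
  by apply: (polyX_dvdW le_do); exists q.
have eqm : phi x ^+ m = - \sum_(1 <= i < m.+1) phi (a i) * phi x ^+ (m - i).
  apply/eqP; rewrite -addr_eq0 -rmorphXn.
  under eq_bigr do rewrite -rmorphXn -rmorphM.
  by rewrite -rmorph_sum -rmorphD eqx rmorph0.
have dvdm : polyX_dvd (o * m).+1 (phi x ^+ m).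
  rewrite eqm -mulN1r; apply: polyX_dvdMl; rewrite big_nat.
  apply: big_ind => [|u v|i /andP[i1 im]].
  - exact: polyX_dvd0.
  - exact: polyX_dvdD.
  have le_om : ((o * m).+1 <= d * i + o * (m - i))%N by nia.
  apply: (polyX_dvdW le_om); apply: polyX_dvdM.
    by apply: (polyX_dvd_exp Id); apply: Ia; rewrite i1.
  by apply: polyX_dvdX; exists q.
move: dvdm; rewrite eq_x exprMn -exprM => /(polyX_dvd_sub (ltnSn _)).
rewrite -horner_coef0 horner_exp horner_coef0 => /eqP.
by rewrite expf_eq0 (negPf q0) andbF.
Qed.

(** This is the kernel of [phi] followed by evaluation at t = 0, a morphism into a domain. *)
Lemma coef0_prime : is_prime_ideal (fun x => (phi x)`_0 = 0).
Proof.
split; first split.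
- by rewrite rmorph0 coef0.
- by move=> x y x0 y0; rewrite rmorphD coefD x0 y0 addr0.
- by move=> x y y0; rewrite rmorphM coef0M y0 mulr0.
- by rewrite rmorph1 coef1; apply/eqP/oner_neq0.
- move=> x y; rewrite rmorphM coef0M => /eqP; rewrite mulf_eq0.
  by case/orP=> /eqP; [left|right].
Qed.

End Valuation.

(** * Weighted gradings of the polynomial ring *)

Section Grading.

Variables (K : fieldType) (n : nat).
Implicit Types (w : 'I_n -> nat) (g f : {mpoly K[n]}).

(** Since x_i is kept in the coefficient, setting t = 0 kills the variables of positive weight and
    fixes the others. *)
Definition grade w : {mpoly K[n]} -> {poly {mpoly K[n]}} :=
  mmap (polyC \o @mpolyC n K) (fun i => ('X_i)%:P * 'X^(w i)).

HB.instance Definition _ w := GRing.RMorphism.copy (grade w)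
  (mmap (polyC \o @mpolyC n K) (fun i => ('X_i)%:P * 'X^(w i))).

Lemma gradeX w i : grade w 'X_i = ('X_i)%:P * 'X^(w i).
Proof. by rewrite /grade mmapX mmap1U. Qed.

Lemma gradeC w c : grade w c%:MP = (c%:MP)%:P.
Proof. by rewrite /grade mmapC. Qed.

Lemma grade_homog g d :
  g \is d.-homog -> grade (fun=> 1%N) g = g%:P * 'X^d.
Proof.
move=> /dhomogP homg; rewrite [g in LHS]mpolyE [g in RHS]mpolyE !rmorph_sum.
rewrite big_distrl; apply: eq_big_seq => m /homg /= md.
rewrite -mul_mpolyC !rmorphM -mulrA; congr (_ * _); first exact: gradeC.
rewrite -md mdegE mpolyXE_id !rmorph_prod -prodrXr -big_split /=.
by apply: eq_bigr => i _; rewrite !rmorphXn /= gradeX exprMn -exprM mul1n.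
Qed.

(* Modulo any ideal containing the variables of positive weight, a polynomial
   is congruent to its specialization of these variables to 0. *)
Lemma grade_coef0_sub w (J : {mpoly K[n]} -> Prop) g :
    is_ideal J -> (forall i, (0 < w i)%N -> J 'X_i) ->
  (grade w g)`_0 = 0 -> J g.
Proof.
move=> [J0 JD JM] Jw g0; rewrite -(subr0 g) -g0 {g0}.
(* [Q] is stable under sums and products, so it suffices to check it on constants and variables. *)
pose Q h := J (h - (grade w h)`_0); rewrite -/(Q g).
have QC c : Q c%:MP by rewrite /Q gradeC coefC subrr.
have QM h1 h2 : Q h1 -> Q h2 -> Q (h1 * h2).
  move=> Q1 Q2; rewrite /Q rmorphM coef0M.
  have -> (u v : {mpoly K[n]}) :
    h1 * h2 - u * v = h2 * (h1 - u) + u * (h2 - v) by ring.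
  exact: (JD _ _ (JM h2 _ Q1) (JM _ _ Q2)).
have QX i : Q 'X_i.
  rewrite /Q gradeX; case: (posnP (w i)) => [->|wi].
    by rewrite mulr1 coefC subrr.
  by rewrite coefMXn wi subr0; apply: Jw.
elim/mpolyind: g => [|c m h _ _ Qh]; first by rewrite /Q rmorph0 coef0 subr0.
have QD h1 h2 : Q h1 -> Q h2 -> Q (h1 + h2).
  by rewrite /Q rmorphD coefD opprD addrACA; apply: JD.
suff QXm : Q 'X_[m].
  by rewrite -mul_mpolyC; exact: (QD _ _ (QM _ _ (QC c) QXm) Qh).
rewrite mpolyXE_id; have Q1 : Q 1 by rewrite -mpolyC1; exact: QC.
apply: (big_ind Q Q1 QM) => i _.
by elim: (m i) => [//|e IHe]; rewrite exprS; exact: (QM _ _ (QX i) IHe).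
Qed.

End Grading.

(** * Products of edges and powers of the edge ideal *)

Section EdgeIdeal.

Variables (K : fieldType) (n : nat) (e : rel 'I_n).
Hypothesis e_sym : ssrbool.symmetric e.
Implicit Types (w : 'I_n -> nat) (J : {mpoly K[n]} -> Prop).

Lemma mpolyX_neq0 m : 'X_[m] != 0 :> {mpoly K[n]}.
Proof. by rewrite -msupp_eq0 msuppX. Qed.

Lemma set2_eqP (T : finType) (a b i j : T) :
  [set a; b] = [set i; j] -> (a = i /\ b = j) \/ (a = j /\ b = i).
Proof.
move=> E.
have: a \in [set i; j] by rewrite -E set21.
have: b \in [set i; j] by rewrite -E set22.
have: i \in [set a; b] by rewrite E set21.
have: j \in [set a; b] by rewrite E set22.
rewrite !inE.
by do 4!case/orP=> /eqP ?; subst; auto.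
Qed.

Lemma mem_edge_set i j : ([set i; j] \in edge_set e) = e i j.
Proof.
apply/imsetP/idP => [[[a b]] /= | eij]; last by exists (i, j); rewrite ?inE.
by rewrite inE /= => eab /set2_eqP [[-> ->]|[-> ->]] ; rewrite // e_sym.
Qed.

(** A list lets edges repeat, and concatenation becomes multiplication. *)
Definition edge_product (m : nat) (y : {mpoly K[n]}) : Prop :=
  exists s : seq ('I_n * 'I_n),
    [/\ size s = m, all (fun p => e p.1 p.2) s
      & y = \prod_(p <- s) ('X_p.1 * 'X_p.2)].

Lemma edge_product0 : edge_product 0 1.
Proof. by exists [::]; rewrite big_nil. Qed.

Lemma edge_product1 i j : e i j -> edge_product 1 ('X_i * 'X_j).
Proof. by move=> eij; exists [:: (i, j)]; rewrite big_seq1 /= eij. Qed.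

Lemma edge_productM m1 m2 y1 y2 :
  edge_product m1 y1 -> edge_product m2 y2 ->
  edge_product (m1 + m2) (y1 * y2).
Proof.
move=> [s [<- es ->]] [t [<- et ->]]; exists (s ++ t).
by rewrite size_cat all_cat es et big_cat.
Qed.

Lemma edge_productX m i j : e i j -> edge_product m (('X_i * 'X_j) ^+ m).
Proof.
move=> eij; elim: m => [|m IHm]; first exact: edge_product0.
by rewrite exprS -add1n; apply: edge_productM => //; apply: edge_product1.
Qed.

Lemma edge_product_homog m y : edge_product m y -> y \is (2 * m).-homog.
Proof.
move=> [s [<- _ ->]]; elim: s => [|p s IHs].
  by rewrite big_nil dhomog1.
rewrite big_cons /= mulnS; apply: dhomogM => //.
by apply: (@dhomogM _ _ _ 1%N _ 1%N); rewrite dhomogX /= mdeg1.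
Qed.

Lemma edge_product_exp m y :
  edge_product m y -> ideal_exp (edge_ideal K e) m y.
Proof.
move=> [s [<- /all_nthP es ->]]; apply: sub_ideal_gen.
case: s es => [|p0 s] es.
  exists (fun=> 0); split=> [[]//|]; by rewrite big_nil big_ord0.
pose u (i : 'I_n * 'I_n) : {mpoly K[n]} := 'X_i.1 * 'X_i.2.
exists (fun i : 'I_(size (p0 :: s)) => u (nth p0 (p0 :: s) i)); split=> [i|].
  apply: sub_ideal_gen; set p := nth _ _ _.
  exists p.1, p.2; split=> //; rewrite mem_edge_set; exact: es.
by rewrite (big_nth p0) big_mkord.
Qed.

Lemma edge_ideal_grade w d x :
    (forall i j, e i j -> w i + w j = d)%N ->
  edge_ideal K e x -> polyX_dvd d (grade w x).
Proof.
move=> we; apply: (ideal_gen_min (polyX_dvd_ideal (grade w) d)).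
move=> _ [i [j [eij ->]]]; exists ('X_i * 'X_j)%:P.
rewrite rmorphM /= !gradeX rmorphM /= mulrACA -exprD (we i j) //.
by rewrite -mem_edge_set.
Qed.

Lemma edge_product_grade w d m y :
    (forall i j, e i j -> w i + w j = d)%N -> edge_product m y ->
  grade w y = y%:P * 'X^(d * m).
Proof.
move=> we [s [<- es ->]]; elim: s es => [_|p s IHs /= /andP[ep /IHs grade_s]].
  by rewrite !big_nil muln0 !rmorph1 mulr1.
rewrite !big_cons rmorphM /= grade_s [X in _ = X * _]rmorphM /= mulnS exprD.
rewrite [RHS]mulrACA; congr (_ * _).
by rewrite rmorphM /= !gradeX rmorphM mulrACA -exprD we.
Qed.

(** * Lower bound for the v-number *)

Section LowerBound.

Variables (k : nat) (J : {mpoly K[n]} -> Prop).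
Hypothesis expJ : forall x, ideal_exp (edge_ideal K e) k x -> J x.
Hypothesis degJ : forall x, J x -> polyX_dvd (2 * k) (grade (fun=> 1%N) x).

Lemma vnumber_ge u v d : e u v -> vnumber_witness J d -> (2 * k - 1 <= d)%N.
Proof.
move=> euv [f [P [homf [primeP _] colonP]]].
have [[_ _ PM] P1 Pprime] := primeP.
have f_neq0 : f != 0.
  apply/eqP => f0; apply: P1; apply/colonP; rewrite /colon f0 mulr0.
  by apply: expJ; have [] := ideal_exp_is_ideal (edge_ideal K e) k.
have Puv : P (('X_u * 'X_v) ^+ k).
  apply/colonP; rewrite /colon mulrC; apply: expJ.
  have [_ _ IM] := ideal_exp_is_ideal (edge_ideal K e) k.
  exact: (IM _ _ (edge_product_exp (edge_productX k euv))).
have PX x m : P (x ^+ m) -> P x.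
  by elim: m => [/P1 //|m IHm]; rewrite exprS => /Pprime [].
have [i /colonP /degJ] : exists i, P 'X_i.
  by case/Pprime: (PX _ _ Puv) => Pi; [exists u|exists v].
have homif : 'X_i * f \is (1 + d).-homog.
  by apply: dhomogM; rewrite // dhomogX /= mdeg1.
(* With all weights 1, the image of x_i f is (x_i f) t^(d+1). If d + 1 < 2k, cancelling t^(d+1)
   would force x_i f = 0. *)
rewrite (grade_homog homif) => dvdf; rewrite leqNgt; apply/negP => lt_d.
have := polyX_dvd_sub _ dvdf; rewrite coefC eqxx => H.
have /eqP : 'X_i * f = 0 by apply: H; lia.
by rewrite mulf_eq0 (negPf f_neq0) orbF (negPf (mpolyX_neq0 _)).
Qed.

End LowerBound.

(** The order of x_b y is (d+1)k + d, one short of (d+1)(k+1). Hence g x_b y in J forces g to vanish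
    at t = 0; the converse reduces to the variables of positive weight. *)
Lemma vnumber_witness_edge k (J : {mpoly K[n]} -> Prop) w d b y :
    (forall x, ideal_exp (edge_ideal K e) k.+1 x -> J x) ->
    (forall x, J x -> polyX_dvd (d.+1 * k.+1) (grade w x)) ->
    (forall i j, e i j -> w i + w j = d.+1)%N -> w b = d ->
    edge_product k y ->
    (forall a, (0 < w a)%N ->
      ideal_exp (edge_ideal K e) k.+1 ('X_a * ('X_b * y))) ->
  vnumber_witness J (2 * k).+1.
Proof.
move=> expJ Jw we wb yk aI.
have homf : 'X_b * y \is (1 + 2 * k).-homog.
  by apply: dhomogM (edge_product_homog yk); rewrite dhomogX /= mdeg1.
have gradef : grade w ('X_b * y) = ('X_b * y)%:P * 'X^(d.+1 * k + d).
  rewrite rmorphM /= gradeX (edge_product_grade we yk) wb rmorphM mulrACA.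
  by rewrite -exprD addnC.
have f_neq0 : 'X_b * y != 0.
  rewrite mulf_neq0 ?mpolyX_neq0 //.
  case: yk => s [_ _ ->]; rewrite prodf_seq_neq0; apply/allP => p _ /=.
  by rewrite mulf_neq0 ?mpolyX_neq0.
set f := 'X_b * y in homf gradef f_neq0 aI.
have colonE : ideal_eq (colon J f) (fun g => (grade w g)`_0 = 0).
  move=> g; split.
    move/Jw; rewrite rmorphM /= gradef mulrA => /polyX_dvd_sub H.
    have /eqP : (grade w g * f%:P)`_0 = 0 by apply: H; nia.
    by rewrite coefMC mulf_eq0 (negPf f_neq0) orbF => /eqP.
  move=> g0; apply: expJ.
  apply: (grade_coef0_sub (J := colon (ideal_exp _ k.+1) f) _ aI g0).
  exact/colon_is_ideal/ideal_exp_is_ideal.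
exists f, (fun g => (grade w g)`_0 = 0); split; [exact: homf| |exact: colonE].
split; first exact: coef0_prime.
by exists f => g; case: (colonE g).
Qed.

End EdgeIdeal.

(** * Odd walks and 2-colourings *)

Section EdgeWalks.

Variables (K : fieldType) (n : nat) (e : rel 'I_n).
Hypothesis e_sym : ssrbool.symmetric e.
Hypothesis e_irr : irreflexive e.
Implicit Types F : {set {set 'I_n}}.

Definition edge_monomials F : {mpoly K[n]} :=
  \prod_(S in F) \prod_(i in S) 'X_i.

Lemma edge_monomial_set2 i j :
  e i j -> \prod_(l in [set i; j]) 'X_l = 'X_i * 'X_j :> {mpoly K[n]}.
Proof.
move=> eij; have ij : i != j by apply: contraTneq eij => ->; rewrite e_irr.
by rewrite big_setU1 ?inE //= big_set1.
Qed.

Lemma edge_monomials_product F :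
  F \subset edge_set e -> edge_product e #|F| (edge_monomials F).
Proof.
rewrite /edge_monomials; elim: {F}_.+1 {-2}F (ltnSn #|F|) => // m IHm F.
have [->|[S SF]] := set_0Vmem F.
  by rewrite big_set0 cards0 => _ _; apply: edge_product0.
rewrite (big_setD1 S) //= (cardsD1 S) SF add1n ltnS => lt_m sFE.
rewrite -add1n; apply: edge_productM; last first.
  by apply: IHm => //; apply: subset_trans sFE; apply: subsetDl.
have /imsetP[[i j]] := subsetP sFE _ SF; rewrite inE /= => eij ->.
by rewrite edge_monomial_set2 //; apply: edge_product1.
Qed.

(* Along a simple odd walk the edges in even positions, together with the two
   end points, cover the same vertices as the edges in odd positions, which
   are one more in number. *)
Lemma even_path_product a p b :
    path e a p -> uniq (a :: p) -> ~~ odd (size p) -> e (last a p) b ->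
  exists F, [/\ F \subset edge_set e,
                forall S, S \in F -> S \subset a :: p
              & edge_product e #|F|.+1 ('X_a * 'X_b * edge_monomials F)].
Proof.
elim: {p}_.+1 a {-2}p (ltnSn (size p)) => // m IHm a [|c [|d p]] //=.
  move=> _ _ _ _ eab; exists set0; split=> [|S|]; rewrite ?sub0set ?inE //.
  by rewrite cards0 /edge_monomials big_set0 mulr1; apply: edge_product1.
rewrite negbK => lt_m /and3P[eac ecd pathp].
rewrite !inE !negb_or -!andbA.
case/and5P=> _ ad ap cd /and3P[cp dp up] oddp last_b.
have lt_p : (size p < m)%N by lia.
have udp : uniq (d :: p) by rewrite /= dp up.
have [F [FE Fp prodF]] := IHm d p lt_p pathp udp oddp last_b.
(* The clause confining F to the vertices of the walk serves here: c is off the remaining walk, so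
   this edge is new. *)
have cdF : [set c; d] \notin F.
  apply: contraL cp => /Fp /subsetP /(_ c); rewrite set21 inE => /(_ isT).
  by rewrite (negPf cd) /= => ->.
exists ([set c; d] |: F); split.
- rewrite subUset FE sub1set andbT; apply/imsetP; exists (c, d) => //.
  by rewrite inE.
- move=> S /setU1P[->|/Fp /subsetP Sp]; apply/subsetP => i.
    by rewrite !inE => /orP[] /eqP ->; rewrite eqxx ?orbT.
  by move/Sp; rewrite !inE => ->; rewrite !orbT.
- rewrite cardsU1 cdF /edge_monomials big_setU1 //= edge_monomial_set2 //.
  rewrite -addnS; set y := \big[_/_]_(_ in F) _.
  have -> : 'X_a * 'X_b * ('X_c * 'X_d * y)
    = 'X_a * 'X_c * ('X_d * 'X_b * y) :> {mpoly K[n]} by ring.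
  exact: edge_productM (edge_product1 _ eac) prodF.
Qed.

Definition colour_rel (c : 'I_n -> bool) : rel 'I_n :=
  [rel x y | e x y && (c x != c y)].

Lemma path_colour c a p :
  path (colour_rel c) a p -> odd (size p) = (c a != c (last a p)).
Proof.
elim: p a => [|d p IHp] a /=; first by rewrite eqxx.
case/andP=> /andP[_ cad] /IHp ->.
by move: cad; case: (c a); case: (c d); case: (c _).
Qed.

(** Shortening a walk may change its parity, but in the bichromatic subgraph the colours of the ends
    fix the parity, so the simple path has even length. The final edge from u to b is under no
    colour condition. *)
Lemma colour_edge_product c a u b :
    connect (colour_rel c) a u -> c a = c u -> e u b ->
  exists F, [/\ F \subset edge_set e
    & edge_product e #|F|.+1 ('X_a * 'X_b * edge_monomials F)].
Proof.
case/connectP=> p0 path0 ->; case/shortenP: path0 => p pathp up _ cau eub.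
have [||F [FE _ prodF]] := even_path_product _ up _ eub; last by exists F.
  by apply: sub_path pathp => x y /andP[].
by rewrite (path_colour pathp) cau eqxx.
Qed.

(** As a set of distinct edges, F divides out of the product of all edges. The edges outside F and
    the copies of uv then bring the count to k + 1. *)
Lemma edge_product_extend k a b u v F :
    F \subset edge_set e -> e u v -> (#|edge_set e| <= k)%N ->
    edge_product e #|F|.+1 ('X_a * 'X_b * edge_monomials F) ->
  edge_product e k.+1 ('X_a * ('X_b * (edge_monomials (edge_set e) *
    ('X_u * 'X_v) ^+ (k - #|edge_set e|)))).
Proof.
move=> FE euv le_k prodF.
have prodFC := edge_monomials_product (subsetDl (edge_set e) F).
have := edge_productM (edge_productM prodF prodFC)
  (edge_productX K (k - #|edge_set e|) euv).
have -> : edge_monomials (edge_set e)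
    = edge_monomials F * edge_monomials (edge_set e :\: F).
  by rewrite /edge_monomials (big_setID F) /= (setIidPr FE).
have := cardsID F (edge_set e); rewrite (setIidPr FE) => cardF.
have -> : (#|F|.+1 + #|edge_set e :\: F| + (k - #|edge_set e|) = k.+1)%N by lia.
by rewrite !mulrA.
Qed.

(* Colour by the parity of the distance to r. *)
Lemma colour_connected (r : 'I_n) :
  connected_graph e -> exists c, forall x y, connect (colour_rel c) x y.
Proof.
move=> e_conn.
(* Tuples of fixed length form a finite type, so this is boolean and [ex_minn] applies. *)
pose walk x := fun m =>
  [exists p : m.-tuple 'I_n, path e r p && (last r p == x)].
have walkP x m : reflect (exists p, [/\ size p = m, path e r p & last r p = x])
    (walk x m).
  apply: (iffP existsP) => [[p /andP[pp /eqP lp]]|[p [sp pp lp]]].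
    by exists p; rewrite size_tuple.
  have sp' : size p == m by apply/eqP.
  by exists (Tuple sp'); rewrite /= pp lp eqxx.
have walkE x : exists m, walk x m.
  have /connectP[p pp ->] := e_conn r x.
  by exists (size p); apply/walkP; exists p.
pose dist x := ex_minn (walkE x).
have distP x : walk x (dist x) by rewrite /dist; case: ex_minnP.
have dist_min x m : walk x m -> (dist x <= m)%N.
  by rewrite /dist; case: ex_minnP => d _ H /H.
pose c x := odd (dist x); exists c.
have col_sym : ssrbool.symmetric (colour_rel c).
  by move=> x y; rewrite /colour_rel /= e_sym eq_sym.
suff conn_r x : connect (colour_rel c) r x.
  move=> x y; apply: connect_trans (conn_r y).
  by rewrite (sym_connect_sym col_sym).
elim: {x}_.+1 {-2}x (ltnSn (dist x)) => // m IHm x lt_m.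
have /walkP[p] := distP x; case/lastP: p => [|p z] [].
  by move=> _ _ <-; apply: connect0.
rewrite size_rcons last_rcons rcons_path => sp /andP[pp ez] zx; subst z.
(* The predecessor y of x on a shortest walk is exactly one step closer to r, so the edge yx is
   bichromatic. *)
set y := last r p in ez.
have le_y : (dist y <= size p)%N by apply: dist_min; apply/walkP; exists p.
have le_x : (dist x <= (dist y).+1)%N.
  have /walkP[q [sq qp lq]] := distP y.
  apply: dist_min; apply/walkP; exists (rcons q x).
  by rewrite size_rcons sq last_rcons rcons_path qp lq.
have dist_y : dist x = (dist y).+1 by lia.
apply: connect_trans (IHm y _) _; first by lia.
by apply: connect1; rewrite /colour_rel /= ez /c dist_y /=; case: odd.
Qed.

End EdgeWalks.

(* In a bipartite graph the weight singles out one side; otherwise it is the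
   degree, and b is an end point of an edge whose ends have the same colour. *)
Lemma weight_data (K : fieldType) (n : nat) (e : rel 'I_n) (u v : 'I_n) :
    simple_graph e -> connected_graph e -> e u v ->
  exists (w : 'I_n -> nat) (d : nat) (b : 'I_n),
    [/\ forall i j, e i j -> (w i + w j = d.+1)%N, w b = d
      & forall a, (0 < w a)%N -> exists F : {set {set 'I_n}},
          F \subset edge_set e /\
          edge_product e #|F|.+1 ('X_a * 'X_b * edge_monomials K F)].
Proof.
move=> [e_sym e_irr] e_conn euv.
have [c c_conn] := colour_connected e_sym u e_conn.
have good a x y : c a = c x -> e x y -> exists F : {set {set 'I_n}},
          F \subset edge_set e /\
    edge_product e #|F|.+1 ('X_a * 'X_y * edge_monomials K F).
  move=> cax exy.
  have [F []] := colour_edge_product K e_irr (c_conn a x) cax exy.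
  by exists F.
have [/existsP[[x y] /= /andP[exy /eqP cxy]]|bip] :=
  boolP [exists p : 'I_n * 'I_n, e p.1 p.2 && (c p.1 == c p.2)].
  exists (fun=> 1%N), 1%N, y; split=> // a _.
  have [cax|cax] := eqVneq (c a) (c x); first exact: good exy.
  (* When a has the other colour, reach b = y through a bichromatic neighbour z of y, which has the
     colour of a. *)
  have /connectP[[|z p] /=] := c_conn y a.
    by move=> _ az; rewrite az cxy eqxx in cax.
  case/andP=> /andP[eyz cyz] _ _; apply: (good a z); last by rewrite e_sym.
  by move: cax cyz; rewrite -cxy; case: (c a); case: (c x); case: (c z).
have cE i j : e i j -> c i != c j.
  move=> eij; apply: contra bip => cij; apply/existsP; exists (i, j).
  by rewrite eij.
(* The colouring is proper: the class of u has weight 1, and v, on the other side, has weight d =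
   0. *)
exists (fun i => c i == c u : nat), 0%N, v; split=> [i j /cE||a].
- by case: (c i); case: (c j); case: (c u).
- by have := cE _ _ euv; rewrite eq_sym => /negPf ->.
- by rewrite lt0b => /eqP cau; apply: good euv.
Qed.

Theorem theorem4p1 (K : fieldType) (n : nat) (e : rel 'I_n)
  (e_simple : simple_graph e) (e_connected : connected_graph e)
  (e_nonempty : edge_set e != set0)
  (k : nat) (hk : (1 + #|edge_set e| <= k)%N) :
  is_vnumber (ideal_exp (edge_ideal K e) k) (2 * k - 1)%N /\
  is_vnumber (integral_closure (ideal_exp (edge_ideal K e) k)) (2 * k - 1)%N.
Proof.
have [e_sym e_irr] := e_simple.
have [S /imsetP[[u v]]] := set0Pn _ e_nonempty; rewrite inE /= => euv _.
(* Containing I^k and obeying the order bounds are all that is needed of J, so both ideals are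
   treated at once. *)
have vnumJ (J : {mpoly K[n]} -> Prop) :
    (forall x, ideal_exp (edge_ideal K e) k x -> J x) ->
    (forall w d x, (forall i j, e i j -> w i + w j = d)%N -> J x ->
       polyX_dvd (d * k) (grade w x)) ->
  is_vnumber J (2 * k - 1).
  move=> expJ Jgrade; split; last first.
    by move=> d; apply: (vnumber_ge e_sym expJ _ euv) => x; apply: Jgrade.
  have [w [d [b [we wb good]]]] := weight_data K e_simple e_connected euv.
  case: k hk expJ Jgrade => // l; rewrite ltnS => hl expJ Jgrade.
  have -> : (2 * l.+1 - 1 = (2 * l).+1)%N by lia.
  (* Every edge occurs once, and copies of uv pad the product to l = k - 1 factors; this uses |E(G)|
     <= l. *)
  pose y : {mpoly K[n]} := edge_monomials K (edge_set e) *
    ('X_u * 'X_v) ^+ (l - #|edge_set e|).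
  have yl : edge_product e l y.
    rewrite -(subnKC hl); apply: edge_productM; last exact: edge_productX.
    exact: edge_monomials_product.
  apply: (vnumber_witness_edge expJ _ we wb yl) => [x|a].
  - exact: Jgrade.
  - case/good=> F [FE prodF]; apply: edge_product_exp => //.
    exact: edge_product_extend prodF.
have ideal_grade w d x : (forall i j, e i j -> w i + w j = d)%N ->
    ideal_exp (edge_ideal K e) k x -> polyX_dvd (d * k) (grade w x).
  move=> we; apply: (@polyX_dvd_exp _ _ (grade w)) => y.
  exact: edge_ideal_grade.
have closure_grade w d x : (forall i j, e i j -> w i + w j = d)%N ->
    integral_closure (ideal_exp (edge_ideal K e) k) x ->
    polyX_dvd (d * k) (grade w x).
  move=> we; apply: (@polyX_dvd_integral _ _ (grade w)) => y.
  exact: ideal_grade.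
split; apply: vnumJ => // x; exact: sub_integral_closure.
Qed.
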